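(* Let $M\in\mathbb{R}^{d\times d}$ be symmetric positive definite, and let $\mathbf u,\mathbf v\in\mathbb{R}^d$ (row covectors) be the normals of two contact manifolds, with $\|\mathbf u\|_g=\|\mathbf v\|_g=1$ and $\mathbf u\neq\pm\mathbf v$ (so they are linearly independent). Let $\mathbf r=\frac{\mathbf u+\mathbf v}{\|\mathbf u+\mathbf v\|_g}$ and $\gamma=\arcsin\langle \mathbf r,\mathbf u\rangle_g$. Then for every momentum covector $\mathbf p_0\in\mathbb{R}^d$ there exists a finite sequence $\mathbf w_1,\dots,\mathbf w_n$ with each $\mathbf w_i\in\{\mathbf u,\mathbf v\}$, which is minimal with respect to $\mathbf p_0$ and has length $n\le\lceil \pi/\gamma\rceil$, such that $$\mathbf p_f=\mathbf p_0\prod_{i=1}^n\Gamma(\mathbf w_i)$$ is feasible.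
   Context: Covectors (elements of the cotangent space $T^*_{q_*}Q$ at the impact configuration $q_*$) are row vectors in $\mathbb{R}^d$, and $M$ is the (symmetric positive definite) mass matrix at $q_*$. The inner product and norm on covectors are $\langle \mathbf a,\mathbf b\rangle_g=\mathbf a M^{-1}\mathbf b^{T}$ and $\|\mathbf a\|_g=\sqrt{\langle\mathbf a,\mathbf a\rangle_g}$. For a nonzero covector $\mathbf w$, the reset map is the matrix $\Gamma(\mathbf w)=I-2\frac{M^{-1}\mathbf w^{T}\mathbf w}{\mathbf w M^{-1}\mathbf w^{T}}$, acting on row covectors from the right, i.e. $\mathbf p\,\Gamma(\mathbf w)=\mathbf p-2\frac{\langle\mathbf p,\mathbf w\rangle_g}{\|\mathbf w\|_g^2}\mathbf w$. Products are ordered from left to right: $\mathbf p\prod_{i=1}^n\Gamma(\mathbf w_i)=\mathbf p\,\Gamma(\mathbf w_1)\Gamma(\mathbf w_2)\cdots\Gamma(\mathbf w_n)$, and the empty product is the identity. A covector $\mathbf p$ is feasible if $\langle\mathbf p,\mathbf u\rangle_g\ge0$ and $\langle\mathbf p,\mathbf v\rangle_g\ge 0$, and infeasible otherwise. A finite sequence $W=(\mathbf w_1,\dots,\mathbf w_n)$ of elements of $\{\mathbf u,\mathbf v\}$ is minimal with respect to a covector $\mathbf p$ if (1) $\mathbf p\prod_{i=1}^n\Gamma(\mathbf w_i)$ is feasible, and (2) no proper subsequence of $W$ (obtained by deleting one or more terms and keeping the order of the rest; the empty sequence is allowed) produces a feasible covector when the corresponding product of reset maps is applied to $\mathbf p$.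 (If $\mathbf p$ is itself feasible, the empty sequence, of length $0$, is minimal.) *)

(* Defs.v *)
From HB Require Import structures.
From mathcomp Require Import all_boot all_order all_algebra.
From mathcomp Require Import all_classical all_reals all_analysis.
Set Implicit Arguments.
Unset Strict Implicit.
Unset Printing Implicit Defensive.
Import Order.TTheory GRing.Theory Num.Theory.

Local Open Scope ring_scope.

Definition posdefmx (R : realType) (d : nat) (M : 'M[R]_d) : Prop :=
  M^T = M /\ forall x : 'rV[R]_d, x != 0 -> 0 < (x *m M *m x^T) 0 0.

Definition cov_dot (R : realType) (d : nat) (M : 'M[R]_d) (a b : 'rV[R]_d) : R :=
  (a *m invmx M *m b^T) 0 0.

Definition cov_norm (R : realType) (d : nat) (M : 'M[R]_d) (a : 'rV[R]_d) : R :=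
  Num.sqrt (cov_dot M a a).

(* Acts on row covectors from the right, [p *m reset_mx M w]; the denominator is
   nonzero when [M] is positive definite and [w] is nonzero. *)
Definition reset_mx (R : realType) (d : nat) (M : 'M[R]_d) (w : 'rV[R]_d) :
    'M[R]_d :=
  1%:M - (2 / (w *m invmx M *m w^T) 0 0) *: (invmx M *m w^T *m w).

(* [\prod] in the ring ['M[R]_d] is [*m] taken from left to right, with empty
   product [1%:M], also for [d = 0]. *)
Definition apply_resets (R : realType) (d : nat) (M : 'M[R]_d)
    (p : 'rV[R]_d) (W : seq 'rV[R]_d) : 'rV[R]_d :=
  p *m \prod_(w <- W) reset_mx M w.

Definition feasible (R : realType) (d : nat) (M : 'M[R]_d)
    (u v p : 'rV[R]_d) : Prop :=
  0 <= cov_dot M p u /\ 0 <= cov_dot M p v.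

(* A subsequence is proper when it deletes at least one term, which for
   [subseq W' W] is the same as [W' != W]. *)
Definition minimal_for (R : realType) (d : nat) (M : 'M[R]_d)
    (u v p : 'rV[R]_d) (W : seq 'rV[R]_d) : Prop :=
  feasible M u v (apply_resets M p W) /\
  forall W' : seq 'rV[R]_d, subseq W' W -> W' != W ->
    ~ feasible M u v (apply_resets M p W').

(* Main.v *)
(** Let [g] be the angle [gamma] of the statement; then [<u,v> = - cos (2 g)],
    and in polar coordinates around [r] the projection of [p] on the plane of
    [u] and [v] gives [<p,u> = rho sin (g + t)] and [<p,v> = rho sin (g - t)]
    with [|t| <= pi].  All [p] with [|t| <= g] are feasible, and the resets by
    [v] and [u] act as [t |-> 2 g - t] and [t |-> - 2 g - t], so that one of
    them turns [|t| <= (2 n + 3) g] into [|t| <= (2 n + 1) g].  Hence [n] resets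
    suffice as soon as [pi <= (2 n + 1) g].  A feasible sequence that is not
    minimal has a shorter feasible subsequence, so minimality costs nothing. *)
Require Import Defs.
From HB Require Import structures.
From mathcomp Require Import all_boot all_order all_algebra.
From mathcomp Require Import all_classical all_reals all_analysis.
From mathcomp Require Import ring lra.
Set Implicit Arguments.
Unset Strict Implicit.
Unset Printing Implicit Defensive.
Import Order.TTheory GRing.Theory Num.Theory.

Local Open Scope ring_scope.

Section CovDot.
Variables (R : realType) (d : nat) (M : 'M[R]_d).
Implicit Types (a b c p w : 'rV[R]_d).

Lemma cov_dotDl a b c : cov_dot M (a + b) c = cov_dot M a c + cov_dot M b c.
Proof. by rewrite /cov_dot !mulmxDl mxE. Qed.

Lemma cov_dotZl k a b : cov_dot M (k *: a) b = k * cov_dot M a b.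
Proof. by rewrite /cov_dot -!scalemxAl mxE. Qed.

Lemma cov_dotNl a b : cov_dot M (- a) b = - cov_dot M a b.
Proof. by rewrite -scaleN1r cov_dotZl mulN1r. Qed.

Lemma cov_dotC : M^T = M -> forall a b, cov_dot M a b = cov_dot M b a.
Proof.
move=> sM a b; rewrite /cov_dot.
transitivity ((a *m invmx M *m b^T)^T 0 0); first by rewrite [RHS]mxE.
by rewrite !trmx_mul trmxK trmx_inv sM mulmxA.
Qed.

Lemma cov_dot_gt0 : posdefmx M -> forall a, a != 0 -> 0 < cov_dot M a a.
Proof.
move=> [sM pM] a a0; rewrite /cov_dot.
(* [invmx M] is [M] itself when [M] is singular. *)
have [uM|nuM] := boolP (M \in unitmx); last by rewrite invmx_out //; exact: pM.
(* For invertible [M], the form of [M] at [a *m invmx M] equals that of [invmx M] at [a]. *)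
have := pM (a *m invmx M); rewrite trmx_mul trmx_inv sM mulmxKV // !mulmxA.
apply; apply: contra_neq a0 => aM.
by rewrite -[a](mulmxKV uM) aM mul0mx.
Qed.

Lemma apply_resets_nil p : apply_resets M p [::] = p.
Proof. by rewrite /apply_resets big_nil mulmx1. Qed.

Lemma apply_resets_cons p w W :
  apply_resets M p (w :: W) = apply_resets M (p *m reset_mx M w) W.
Proof. by rewrite /apply_resets big_cons mulmxA. Qed.

Lemma reset_mxE p w :
  p *m reset_mx M w = p - (2 * cov_dot M p w / cov_dot M w w) *: w.
Proof.
rewrite /reset_mx mulmxBr mulmx1 -scalemxAr !mulmxA.
rewrite [p *m invmx M *m w^T]mx11_scalar mul_scalar_mx scalerA.
by rewrite /cov_dot mulrAC.
Qed.

End CovDot.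

(** Strong induction on the length: as long as a proper subsequence stays feasible, pass to it; it
    is strictly shorter. *)
Lemma minimal_for_exists (R : realType) (d : nat) (M : 'M[R]_d)
    (u v p : 'rV[R]_d) (W : seq 'rV[R]_d) :
  {subset W <= [:: u; v]} -> feasible M u v (apply_resets M p W) ->
  exists W', [/\ {subset W' <= [:: u; v]}, (size W' <= size W)%N
                & minimal_for M u v p W'].
Proof.
have [n] := ubnP (size W); elim: n W => // n IHn W ltWn sW fW.
have [[W' [sub neq fW']]|noW'] :=
  pselect (exists W', [/\ subseq W' W, W' != W
                         & feasible M u v (apply_resets M p W')]); last first.
  by exists W; split=> //; split=> // W' sub neq fW'; apply: noW'; exists W'.
have ltW : (size W' < size W)%N.
  by rewrite (ltn_leqif (size_subseq_leqif sub)).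
have [|||W2 [sW2 leW2 mW2]] := IHn W' => //.
- exact: leq_trans ltW ltWn.
- by move=> w /(mem_subseq sub)/sW.
- by exists W2; split=> //; apply: leq_trans leW2 (ltnW ltW).
Qed.

Section Trigonometry.
Variable R : realType.
Implicit Types (x y t g : R).

(** The arccosine of [x / rho] gives the angle up to sign, and the sign of [y] decides between the
    two candidates. *)
Lemma polar_coordinates x y :
  exists rho t : R,
    [/\ 0 <= rho, - pi <= t <= pi, x = rho * cos t & y = rho * sin t].
Proof.
pose rho := Num.sqrt (x ^+ 2 + y ^+ 2).
have rho2 : rho ^+ 2 = x ^+ 2 + y ^+ 2.
  by rewrite sqr_sqrtr // addr_ge0 ?sqr_ge0.
have rho_ge0 : 0 <= rho by exact: sqrtr_ge0.
have [rho0|rho0] := eqVneq rho 0.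
  have [/eqP x0 /eqP y0] : x == 0 /\ y == 0.
    move: rho2; rewrite rho0 expr0n /= => /esym/eqP.
    by rewrite paddr_eq0 ?sqr_ge0 // !sqrf_eq0 => /andP[].
  exists 0, 0; rewrite x0 y0 !mul0r lexx; split=> //.
  by rewrite oppr_le0 pi_ge0.
have rho_gt0 : 0 < rho by rewrite lt_def rho0.
have xle : -1 <= x / rho <= 1.
  rewrite -ler_norml normrM normfV (gtr0_norm rho_gt0) ler_pdivrMr // mul1r.
  by rewrite -(ger0_norm rho_ge0) -ler_sqr ?nnegrE // !real_normK ?num_real //
     rho2 lerDl sqr_ge0.
have xE : x = rho * cos (acos (x / rho)).
  by rewrite acosK ?in_itv //= mulrC divfK.
have [t_ge0 t_le] : 0 <= acos (x / rho) /\ acos (x / rho) <= pi.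
  by rewrite acos_ge0 // acos_lepi.
(* Both sides are nonnegative, the sine because the arccosine lies in [0, pi], so it suffices to
   compare squares. *)
have sE : `|y| = rho * sin (acos (x / rho)).
  apply/eqP; rewrite -(@eqrXn2 _ 2) ?mulr_ge0 ?sin_ge0_pi ?t_ge0 //.
  rewrite real_normK ?num_real // exprMn sin2cos2 mulrBr mulr1 -exprMn -xE rho2.
  by apply/eqP; ring.
have := @pi_ge0 R => pi0.
have [y0|y0] := leP 0 y.
  exists rho, (acos (x / rho)); split=> //; first by apply/andP; split; lra.
  by rewrite -sE ger0_norm.
exists rho, (- acos (x / rho)); split=> //; first by apply/andP; split; lra.
  by rewrite cosN.
by rewrite sinN mulrN -sE ltr0_norm // opprK.
Qed.

(** The two equations say [x + y = 2 * rho * sin g * cos t] and [x - y = 2 * rho * cos g * sin t];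
    this gives the point whose polar coordinates are taken. *)
Lemma cone_coordinates g x y : 0 < g < pi / 2 ->
  exists rho t : R, [/\ 0 <= rho, - pi <= t <= pi,
    x = rho * sin (g + t) & y = rho * sin (g - t)].
Proof.
move=> /andP[g0 g1].
have s0 : sin g != 0 by rewrite gt_eqF // sin_gt0_pihalf // g0.
have c0 : cos g != 0.
  rewrite gt_eqF // cos_gt0_pihalf // g1 andbT.
  by have := @pi_ge0 R; lra.
have [rho [t [r0 tpi cE sE]]] :=
  polar_coordinates ((x + y) / (2 * sin g)) ((x - y) / (2 * cos g)).
exists rho, t; split=> //.
  rewrite sinD mulrDr [sin g * _]mulrC [cos g * _]mulrC !mulrA -cE -sE.
  by field; apply/andP.
rewrite sinB mulrBr [sin g * _]mulrC [cos g * _]mulrC !mulrA -cE -sE.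
by field; apply/andP.
Qed.

(** Sum-to-product for the angles [2 * g + (g - t)] and [2 * g - (g - t)]. It describes the effect
    on [<p,u>] of the reset by [v]. *)
Lemma sin_reflect g t :
  sin (g + (2 * g - t)) = sin (g + t) + 2 * cos (2 * g) * sin (g - t).
Proof.
have -> : g + (2 * g - t) = 2 * g + (g - t) by ring.
have -> : g + t = 2 * g - (g - t) by ring.
by rewrite (sinD (2 * g)) (sinB (2 * g)); ring.
Qed.

End Trigonometry.

Section Cone.
Variables (R : realType) (d : nat) (M : 'M[R]_d) (u v : 'rV[R]_d) (g : R).
Hypotheses (sM : M^T = M) (uu : cov_dot M u u = 1) (vv : cov_dot M v v = 1).
Hypotheses (g_bnd : 0 < g < pi / 2) (uv : cov_dot M u v = - cos (2 * g)).

(** Induction on [n], resetting by [v] when [t > g] and by [u] when [t < - g]. Only the two products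
    with [u] and [v] are tracked, and [rho] is the same throughout. *)
Lemma feasible_of_angle (n : nat) (rho t : R) (p : 'rV[R]_d) :
  0 <= rho -> `|t| <= (2 * n%:R + 1) * g ->
  cov_dot M p u = rho * sin (g + t) -> cov_dot M p v = rho * sin (g - t) ->
  exists W, [/\ {subset W <= [:: u; v]}, (size W <= n)%N
               & feasible M u v (apply_resets M p W)].
Proof.
move=> r0; have /andP[g0 g1] := g_bnd.
have vu : cov_dot M v u = - cos (2 * g) by rewrite cov_dotC.
elim: n t p => [|n IHn] t p.
  rewrite mulr0 add0r mul1r ler_norml => /andP[t1 t2] pu pv.
  exists [::]; split=> //; rewrite apply_resets_nil /feasible pu pv.
  by split; apply: mulr_ge0 => //; apply: sin_ge0_pi; apply/andP; split; lra.
rewrite ler_norml mulrS => /andP[t1 t2] pu pv.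
have n0 : 0 <= n%:R * g by rewrite mulr_ge0 // ltW.
have [tg|tg] := leP t g; last first.
  have [||| W [sW leW fW]] := IHn (2 * g - t) (p *m reset_mx M v).
  - by rewrite ler_norml; apply/andP; split; nra.
  - rewrite reset_mxE vv divr1 cov_dotDl cov_dotNl cov_dotZl vu pu pv.
    by rewrite sin_reflect; ring.
  - rewrite reset_mxE vv divr1 cov_dotDl cov_dotNl cov_dotZl vv pv.
    have -> : g - (2 * g - t) = - (g - t) by ring.
    by rewrite sinN; ring.
  exists (v :: W); split=> //; last by rewrite apply_resets_cons.
  by move=> w; rewrite inE => /predU1P[->|/sW//]; rewrite !inE eqxx orbT.
have [tg'|tg'] := leP (- g) t.
  exists [::]; split=> //; rewrite apply_resets_nil /feasible pu pv.
  by split; apply: mulr_ge0 => //; apply: sin_ge0_pi; apply/andP; split; lra.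
have [||| W [sW leW fW]] := IHn (- (2 * g + t)) (p *m reset_mx M u).
- by rewrite ler_norml; apply/andP; split; nra.
- rewrite reset_mxE uu divr1 cov_dotDl cov_dotNl cov_dotZl uu pu.
  have -> : g + - (2 * g + t) = - (g + t) by ring.
  by rewrite sinN; ring.
- rewrite reset_mxE uu divr1 cov_dotDl cov_dotNl cov_dotZl uv pu pv opprK.
  (* Changing the sign of [t] exchanges the roles of [u] and [v]. *)
  by have := sin_reflect g (- t); rewrite !opprK => ->; ring.
exists (u :: W); split=> //; last by rewrite apply_resets_cons.
by move=> w; rewrite inE => /predU1P[->|/sW//]; rewrite !inE eqxx.
Qed.

End Cone.

Theorem theorem1 (R : realType) (d : nat) (M : 'M[R]_d) (u v : 'rV[R]_d)
    (hM : posdefmx M)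
    (hu : cov_norm M u = 1) (hv : cov_norm M v = 1)
    (huv : u <> v) (huNv : u <> - v) :
  let r : 'rV[R]_d := (cov_norm M (u + v))^-1 *: (u + v) in
  let gamma : R := asin (cov_dot M r u) in
  forall p0 : 'rV[R]_d,
  exists W : seq 'rV[R]_d,
    [/\ forall w : 'rV[R]_d, w \in W -> w = u \/ w = v,
        minimal_for M u v p0 W,
        ((size W)%:Z <= Num.ceil (pi / gamma))%R
      & feasible M u v (apply_resets M p0 W)].
Proof.
move=> r g p0; have sM := hM.1; have pi_ge0R := @pi_ge0 R.
have norm1 w : cov_norm M w = 1 -> cov_dot M w w = 1.
  (* [Num.sqrt] is 0 on negative reals, so the sign of [cov_dot M w w] has to be known before
     squaring. *)
  move=> w1; have : 0 < cov_norm M w by rewrite w1.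
  by rewrite sqrtr_gt0 => w0; rewrite -(sqr_sqrtr (ltW w0)) -/(cov_norm M w) w1
    expr1n.
have uu := norm1 _ hu; have vv := norm1 _ hv.
set c := cov_dot M u v; have vu : cov_dot M v u = c by rewrite cov_dotC.
(* Strict Cauchy-Schwarz: [u + v] and [u - v] are nonzero, with squared norms [2 * (1 + c)] and
   [2 * (1 - c)]. *)
have c_gtN1 : -1 < c.
  have : 0 < cov_dot M (u + v) (u + v).
    by apply: cov_dot_gt0 => //; rewrite addr_eq0; apply/eqP.
  by rewrite cov_dotDl !(cov_dotC sM _ (u + v)) !cov_dotDl uu vv vu -/c; lra.
have c_lt1 : c < 1.
  have : 0 < cov_dot M (u - v) (u - v).
    by apply: cov_dot_gt0 => //; rewrite subr_eq0; apply/eqP.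
  rewrite cov_dotDl cov_dotNl !(cov_dotC sM _ (u - v)) !cov_dotDl !cov_dotNl.
  by rewrite uu vv vu -/c; lra.
have nE : cov_norm M (u + v) = Num.sqrt (2 * (1 + c)).
  rewrite /cov_norm cov_dotDl !(cov_dotC sM _ (u + v)) !cov_dotDl uu vv vu -/c.
  by congr Num.sqrt; ring.
set s := cov_dot M r u.
have n_gt0 : 0 < cov_norm M (u + v) by rewrite nE sqrtr_gt0; lra.
have n2 : cov_norm M (u + v) ^+ 2 = 2 * (1 + c) by rewrite nE sqr_sqrtr //; lra.
have sE : s = cov_norm M (u + v) / 2.
  rewrite /s /r cov_dotZl cov_dotDl uu vu.
  have -> : 1 + c = cov_norm M (u + v) ^+ 2 / 2 by rewrite n2; field.
  by field; rewrite gt_eqF.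
have s_gt0 : 0 < s by rewrite sE; lra.
have s2 : s ^+ 2 = (1 + c) / 2 by rewrite sE expr_div_n n2; field.
have s_lt1 : s < 1.
  by rewrite -(@ltr_pXn2r _ 2) ?nnegrE ?ler01 ?ltW // s2 expr1n; lra.
have s_bnd : -1 <= s <= 1 by apply/andP; split; lra.
have sing : sin g = s by rewrite asinK // in_itv.
have g_lt : g < pi / 2 by apply: (@asin_ltpi2 _ s); apply/andP; split; lra.
have g_geN : - (pi / 2) <= g by exact: asin_geNpi2.
have g_gt0 : 0 < g.
  rewrite ltNge; apply/negP => g_le0.
  have : 0 <= sin (- g).
    by apply: sin_ge0_pi; apply/andP; split; lra.
  by rewrite sinN sing; lra.
have g_bnd : 0 < g < pi / 2 by rewrite g_gt0.
(* Double angle: [cos (2 * g) = 1 - 2 * s ^+ 2], which is [- c] by [s2]. *)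
have uvE : cov_dot M u v = - cos (2 * g).
  have -> : 2 * g = g + g by ring.
  by rewrite cosD -!expr2 cos2sin2 sing s2 -/c; field.
have [rho [t [r0 t_bnd pu pv]]] :=
  cone_coordinates (cov_dot M p0 u) (cov_dot M p0 v) g_bnd.
have q_ge0 : 0 <= pi / g by rewrite divr_ge0 ?pi_ge0 // ltW.
pose n := `|Num.ceil (pi / g)|%N.
have nE' : n%:Z = Num.ceil (pi / g).
  by rewrite gez0_abs //; rewrite -(@ler_int R); apply: le_trans (ceil_ge _).
(* This implies the bound [pi <= (2 * n%:R + 1) * g] under which [n] resets suffice. *)
have le_n : pi <= n%:R * g.
  by rewrite -ler_pdivrMr // -[n%:R]/(n%:Z%:~R) nE' ceil_ge.
have [|W0 [sW0 leW0 fW0]] :=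
  feasible_of_angle (n := n) sM uu vv g_bnd uvE r0 _ pu pv.
  by move: t_bnd => /andP[? ?]; rewrite ler_norml; apply/andP; split; lra.
have [W [sW leW mW]] := minimal_for_exists sW0 fW0.
exists W; split=> //; last by case: mW.
  by move=> w /sW; rewrite !inE => /orP[]/eqP; [left|right].
by rewrite -nE' lez_nat (leq_trans leW).
Qed.
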